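(* Let $G_1,G_2$ be finite groups, $S_1\subset G_1$ and $S_2\subset G_2$. If $Spec(X(G_1,S_1))\subset\mathbb{R}$ and $Spec(X(G_2,S_2))\subset\mathbb{R}$, then the graphs $MX^*(G_1;S_1,S_1)$ and $MX^*(G_2;S_2,S_2)$ are equienergetic if and only if the graphs $X^*(G_1,S_1)$ and $X^*(G_2,S_2)$ are equienergetic.
   Context: $X(G,S)$ is the Cayley graph with vertex set $G$ and a directed edge from $h$ to $g$ iff $gh^{-1}\in S$; $X^+(G,S)$ is the Cayley sum graph with vertex set $G$ and a directed edge from $h$ to $g$ iff $gh\in S$ (loops allowed). $X^*(G,S)$ denotes either one; a statement with $*$ is asserted for both choices, the same choice being made throughout. If $A$ is the adjacency matrix of $X^*(G,S)$, then $MX^*(G;S,S)$ is the graph with vertex set $G\times\mathbb{Z}_2$ and adjacency matrix $\begin{pmatrix}A&A\\ A&A\end{pmatrix}$. $Spec$ is the multiset of complex eigenvalues of the adjacency matrix counted with (algebraic) multiplicity, and the energy is $\mathcal{E}(\Gamma)=\sum_{\lambda\in Spec(\Gamma)}|\lambda|$. Two graphs with the same number of vertices are equienergetic if they have the same energy. *)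

(* Defs.v *)
From HB Require Import structures.
From mathcomp Require Import all_boot all_order all_algebra all_fingroup.
From mathcomp Require Import reals complex.

Set Implicit Arguments.
Unset Strict Implicit.
Unset Printing Implicit Defensive.

Import Order.TTheory GRing.Theory Num.Theory.
Local Open Scope ring_scope.

(* Directed, loops allowed; [edge h g] means that there is an edge from h to
   g. *)
Record digraph := Digraph { vertex :> finType; edge : rel vertex }.

(* The vertices are listed in the order of [enum]; another order conjugates the
   matrix by a permutation and leaves the spectrum unchanged. *)
Definition adjacency (C : numClosedFieldType) (X : digraph) : 'M[C]_#|X| :=
  \matrix_(i, j) (edge (enum_val i : X) (enum_val j : X))%:R.

(* Used with C := R[i], R : realType. A sequence standing for a multiset: the
   roots of the characteristic polynomial, each repeated according to its
   algebraic multiplicity. *)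
Definition Spec (C : numClosedFieldType) (X : digraph) : seq C :=
  sval (closed_field_poly_normal (char_poly (adjacency C X))).

Lemma char_poly_Spec (C : numClosedFieldType) (X : digraph) :
  char_poly (adjacency C X) = \prod_(z <- Spec C X) ('X - z%:P).
Proof.
rewrite /Spec; case: closed_field_poly_normal => r /= Dr.
by rewrite {1}Dr (monicP (char_poly_monic _)) scale1r.
Qed.

Definition energy (C : numClosedFieldType) (X : digraph) : C :=
  \sum_(z <- Spec C X) `|z|.

Definition equienergetic (C : numClosedFieldType) (X Y : digraph) : Prop :=
  #|X| = #|Y| /\ energy C X = energy C Y.

(* The choice written * in X^*(G,S) and MX^*(G;S,S). *)
Inductive cayley_kind := CayleyGraph | CayleySumGraph.

Section Cayley.
Variable gT : finGroupType.
Implicit Type S : {set gT}.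

Definition cayley S : digraph :=
  Digraph (fun h g : gT => (g * h^-1)%g \in S).

Definition cayley_sum S : digraph :=
  Digraph (fun h g : gT => (g * h)%g \in S).

Definition cayley_star (k : cayley_kind) S : digraph :=
  match k with
  | CayleyGraph => cayley S
  | CayleySumGraph => cayley_sum S
  end.

End Cayley.

(* The graph on X * Z_2 whose adjacency matrix is [[A, A], [A, A]], where A is
   that of X: as the four blocks agree, the Z_2 components do not matter. The
   block form is [adjacency_double]. *)
Definition double (X : digraph) : digraph :=
  Digraph (fun u v : X * 'Z_2 => edge u.1 v.1).

Definition MX_star (gT : finGroupType) (k : cayley_kind) (S : {set gT}) :=
  double (cayley_star k S).

(* The listing of X * Z_2 that puts X * {0} before X * {1}. *)
Definition double_index (X : digraph) (k : 'I_(#|X| + #|X|)) : 'I_#|double X| :=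
  enum_rank (match split k with
             | inl i => (enum_val i : X, 0)
             | inr i => (enum_val i : X, 1)
             end : X * 'Z_2).

Lemma double_index_bij (X : digraph) : bijective (@double_index X).
Proof.
apply: inj_card_bij => [k l /enum_rank_inj | ]; last first.
  by rewrite !card_ord card_prod card_ord muln2 addnn.
case: splitP => i ki; case: splitP => j lj // -[/enum_val_inj ij];
  by apply: val_inj; rewrite /= ki lj ij.
Qed.

Lemma adjacency_double (C : numClosedFieldType) (X : digraph) :
  let A := adjacency C X in
  mxsub (@double_index X) (@double_index X) (adjacency C (double X)) =
    block_mx A A A A.
Proof.
move=> A; apply/matrixP=> k l; rewrite !mxE /double_index !enum_rankK /=.
by case: (split k) => i; rewrite !mxE; case: (split l) => j; rewrite !mxE.
Qed.

(* Main.v *)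
Require Import Defs.
From HB Require Import structures.
From mathcomp Require Import all_boot all_order all_algebra all_fingroup.
From mathcomp Require Import reals complex.

Set Implicit Arguments.
Unset Strict Implicit.
Unset Printing Implicit Defensive.

Import Order.TTheory GRing.Theory Num.Theory.
Local Open Scope ring_scope.

(** The statement is an instance of a fact about every finite digraph X, by
    which [double X] has twice the energy of X. If A is the adjacency matrix of
    X, of size n, then conjugating [[A, A], [A, A]] by a unitriangular block
    matrix makes it block triangular with diagonal blocks A + A and A - A, so
    that its eigenvalues are the doubles of those of A, together with n zeros
    ([char_poly_block_sym], [char_poly_scale], [perm_Spec_double]). Summing
    absolute values gives [energy_double]. As [double] also doubles the number
    of vertices, and doubling is injective both on naturals and on complex
    numbers, two digraphs are equienergetic exactly when their doubles are. *)

(** The same reordering of rows and of columns contributes the sign of one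
    permutation twice. The sizes m and p are kept apart because a reordering
    such as [double_index] relates sizes that are only provably equal. *)
Lemma det_mxsub_bij (R : comPzRingType) (m p : nat) (f : 'I_m -> 'I_p)
    (M : 'M[R]_p) :
  bijective f -> \det (mxsub f f M) = \det M.
Proof.
move=> f_bij; have := bij_eq_card f_bij; rewrite !card_ord => def_p.
case: p / def_p f f_bij M => f f_bij M.
pose s := perm (bij_inj f_bij).
have -> : mxsub f f M = row_perm s (col_perm s M).
  by apply/matrixP=> i j; rewrite !mxE !permE.
rewrite row_permE col_permE !det_mulmx !det_perm odd_permV.
by rewrite mulrCA -signr_addb addbb mulr1.
Qed.

Lemma char_poly_mxsub_bij (R : comNzRingType) (m p : nat) (f : 'I_m -> 'I_p)
    (M : 'M[R]_p) :
  bijective f -> char_poly (mxsub f f M) = char_poly M.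
Proof.
move=> f_bij; rewrite /char_poly -(det_mxsub_bij _ f_bij); congr (\det _).
by apply/matrixP=> i j; rewrite !mxE (inj_eq (bij_inj f_bij)).
Qed.

(** The column vectors (x, x) form an invariant subspace, on which the matrix
    acts as A + B, and it acts as A - B on the quotient, represented by the
    (0, x). Taking (x, -x) for the complement would diagonalise the blocks, but
    only where 2 is invertible. *)
Lemma char_poly_block_sym (R : comNzRingType) (n : nat) (A B : 'M[R]_n) :
  char_poly (block_mx A B B A) = char_poly (A + B) * char_poly (A - B).
Proof.
pose L : 'M[{poly R}]_(n + n) := block_mx 1%:M 0 (- 1%:M) 1%:M.
pose U : 'M[{poly R}]_(n + n) := block_mx 1%:M 0 1%:M 1%:M.
have detL : \det L = 1 by rewrite det_lblock !det1 mulr1.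
have detU : \det U = 1 by rewrite det_lblock !det1 mulr1.
rewrite {1}/char_poly -[LHS]mul1r -[LHS]mulr1 -{1}detL -{1}detU.
rewrite -2![in LHS]det_mulmx.
rewrite /char_poly_mx map_block_mx (scalar_mx_block n n) opp_block_mx.
rewrite add_block_mx !mulmx_block !(mul1mx, mulmx1, mul0mx, mulmx0, mulNmx).
set c := 'X%:M; set a := map_mx _ A; set b := map_mx _ B.
rewrite !(addr0, add0r).
have -> : - (c - a) - b + (- - b + (c - a)) = 0.
  by rewrite opprK addrA subrK addNr.
rewrite det_ublock /char_poly /char_poly_mx map_mxD map_mxB -/a -/b -/c.
by rewrite opprK opprD opprB !addrA [b + c]addrC.
Qed.

(** Scaling a matrix scales its eigenvalues: substituting X / a for X in the
    characteristic matrix of A gives that of a A divided by a. *)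
Lemma char_poly_scale (F : fieldType) (n : nat) (a : F) (A : 'M[F]_n)
    (r : seq F) :
    a != 0 -> char_poly A = \prod_(z <- r) ('X - z%:P) ->
  char_poly (a *: A) = \prod_(z <- r) ('X - (a * z)%:P).
Proof.
move=> a_neq0 charA.
have size_r : size r = n.
  by apply: succn_inj; rewrite -(size_char_poly A) charA size_prod_XsubC.
have XsubCZ z : ('X - z%:P) \Po (a^-1 *: 'X) = a^-1%:P * ('X - (a * z)%:P).
  rewrite comp_polyB comp_polyX comp_polyC mulrBr -polyCM mulKf //.
  by rewrite mul_polyC.
have charZ : char_poly A \Po (a^-1 *: 'X) = a^-1%:P ^+ n * char_poly (a *: A).
  rewrite /char_poly -detZ -det_map_mx; congr (\det _).
  apply/matrixP=> i j; rewrite !mxE /= comp_polyB comp_polyC raddfMn /=.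
  rewrite comp_polyX mulrBr -polyCM mulKf // mulrnAr.
  by rewrite mul_polyC.
have an_neq0 : a^-1%:P ^+ n != 0 :> {poly F}.
  by rewrite expf_neq0 // polyC_eq0 invr_eq0.
apply: (mulfI an_neq0); rewrite -charZ charA rmorph_prod /=.
rewrite (eq_bigr _ (fun z _ => XsubCZ z)) big_split /=.
by rewrite big_const_seq count_predT size_r iter_mulr_1.
Qed.

Lemma perm_Spec_double (C : numClosedFieldType) (X : digraph) :
  perm_eq (Spec C (Defs.double X)) ([seq 2 * z | z <- Spec C X] ++ nseq #|X| 0).
Proof.
apply: prod_XsubC_eq; rewrite -char_poly_Spec.
rewrite -(char_poly_mxsub_bij _ (@double_index_bij X)) adjacency_double.
rewrite char_poly_block_sym subrr -mulr2n -scaler_nat.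
rewrite (char_poly_scale _ (@char_poly_Spec C X)) ?pnatr_eq0 //.
rewrite big_cat big_map big_nseq iter_mulr_1 /=; congr (_ * _).
by rewrite /char_poly /char_poly_mx map_mx0 subr0 det_scalar subr0.
Qed.

Lemma energy_double (C : numClosedFieldType) (X : digraph) :
  energy C (Defs.double X) = 2 * energy C X.
Proof.
rewrite /energy (perm_big _ (perm_Spec_double C X)) big_cat big_map /=.
rewrite [X in _ + X]big_nseq normr0 iter_addr_0 mul0rn addr0 mulr_sumr.
by apply: eq_bigr => z _; rewrite normrM normr_nat.
Qed.

Lemma equienergetic_double (C : numClosedFieldType) (X Y : digraph) :
  equienergetic C (Defs.double X) (Defs.double Y) <-> equienergetic C X Y.
Proof.
have card_double Z : #|Defs.double Z| = (#|Z| * 2)%N.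
  by rewrite card_prod card_ord.
rewrite /equienergetic !energy_double !card_double.
split=> [[cardXY /mulfI eXY] | [-> ->] //].
by split; [apply/eqP; rewrite -(eqn_pmul2r (isT : 0 < 2)%N) cardXY
          | apply: eXY; rewrite pnatr_eq0].
Qed.

Theorem proposition7p5 (R : realType) (G1 G2 : finGroupType)
    (S1 : {set G1}) (S2 : {set G2}) (k : cayley_kind) :
  {subset Spec R[i] (cayley S1) <= Num.real} ->
  {subset Spec R[i] (cayley S2) <= Num.real} ->
  equienergetic R[i] (MX_star k S1) (MX_star k S2) <->
  equienergetic R[i] (cayley_star k S1) (cayley_star k S2).
Proof. by move=> _ _; apply: equienergetic_double. Qed.
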